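(* Let $\mathcal{L}=\{l_1,\dots,l_s\}$ be a set of $s$ nonnegative integers with $l_{1} < l_{2} < \cdots <l_{s}$ and $\mathbb{F}_{q}$ be a finite field of order $q$. Suppose that $\mathcal{V} = \{V_{1}, \ldots, V_{m}\}$ is a collection of subspaces of an $n$-dimensional vector space over $\mathbb{F}_{q}$ such that $\mathrm{dim}(V_{i} \cap V_{j}) \in \mathcal{L}$ for any distinct $V_{i}, V_{j}\in\mathcal{V}$. Let $k = \max\{\dim(V_{j}) : 1 \le j \le m\}$. If $n \ge \log_{q}\big((q^{s} - 1)\binom{k^{2}}{l_{1} + 1}_{q} + 1\big) + l_{1}$, then \[ |\mathcal{V}| \le \binom{n - l_{1}}{s}_{q} + \binom{n - l_{1}}{s - 1}_{q} + \cdots + \binom{n - l_{1}}{0}_{q}. \]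
   Context: Here $\binom{n}{k}_{q} := \prod_{0 \le i \leq k - 1} \frac{q^{n - i}-1}{q^{k - i}-1}$ denotes the Gaussian binomial coefficient, i.e. the number of $k$-dimensional subspaces of an $n$-dimensional vector space over $\mathbb{F}_q$; $q$ is a prime power. *)

(* Defs.v *)
From HB Require Import structures.
From mathcomp Require Import all_boot all_order all_algebra.
From mathcomp Require Import finmap reals exp.

Set Implicit Arguments.
Unset Strict Implicit.
Unset Printing Implicit Defensive.

Import Order.TTheory GRing.Theory Num.Theory.
Local Open Scope ring_scope.

(* The exponents use truncated subtraction. For k <= n no truncation occurs;
   for k > n the factor i = n vanishes, so the value is 0, the number of
   k-dimensional subspaces of an n-dimensional space. *)
Definition gauss_binom (R : fieldType) (q n k : nat) : R :=
  \prod_(i < k) ((q%:R ^+ (n - i) - 1) / (q%:R ^+ (k - i) - 1)).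

Definition log_base (R : realType) (b x : R) : R := ln x / ln b.

(* Main.v *)
(* Counting functions W |-> prod_j (q ^ dim (U :&: W) - q ^ j) against the
   indicators of T <= W shows that a family of subspaces all containing B, with
   s possible pairwise intersection dimensions, has at most as many members as
   there are T >= B with dim T <= dim B + s. If the members of V share a subspace
   of dimension l1, take it as B. Otherwise some W of dimension at most k ^ 2 meets
   every member in dimension at least l1 + 1. Distribute V over the
   (l1 + 1)-dimensional subspaces T of W: each class contains T and has only s - 1
   intersection dimensions left, so the first bound with B = T gains a factor
   (q ^ (n - l1) - 1) / (q ^ s - 1), which by hypothesis pays for the number of
   choices of T. *)
Require Import Defs.
From HB Require Import structures.
From mathcomp Require Import all_boot all_order all_algebra.
From mathcomp Require Import finmap reals exp.
From mathcomp Require Import finfield zify ring.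

Set Implicit Arguments.
Unset Strict Implicit.
Unset Printing Implicit Defensive.

Import Order.TTheory GRing.Theory Num.Theory.
Local Open Scope ring_scope.

(** A subspace is stored as a matrix over [F], so countability and finiteness carry over from
    matrices; families can then be handled as finite sets. *)
HB.instance Definition _ (F : finFieldType) (vT : vectType F) :=
  isCountable.Build {vspace vT}
    (pcan_pickleK (can_pcan (@VectorInternalTheory.vs2mxK F vT))).
HB.instance Definition _ (F : finFieldType) (vT : vectType F) :=
  isFinite.Build {vspace vT}
    (pcan_enumP (can_pcan (@VectorInternalTheory.vs2mxK F vT))).

(** * Sign, monotonicity and recursion of Gaussian binomials *)

Section GaussBinomial.

Variables (R : numFieldType) (q : nat).
Hypothesis q_gt1 : (1 < q)%N.

Lemma subr1_exp_gt0 n : (0 < n)%N -> 0 < (q%:R : R) ^+ n - 1.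
Proof. by move=> n0; rewrite subr_gt0 exprn_egt1 ?ltr1n // -lt0n. Qed.

Lemma subr1_exp_ge0 n : 0 <= (q%:R : R) ^+ n - 1.
Proof. by rewrite subr_ge0 exprn_ege1 // ler1n ltnW. Qed.

Lemma subr1_exp_le m n :
  (m <= n)%N -> (q%:R : R) ^+ m - 1 <= q%:R ^+ n - 1.
Proof. by move=> mn; rewrite lerD2r ler_weXn2l // ler1n ltnW. Qed.

Lemma gauss_binom0 n : gauss_binom R q n 0 = 1.
Proof. by rewrite /gauss_binom big_ord0. Qed.

Lemma gauss_binomS n d : gauss_binom R q n d.+1 =
  (q%:R ^+ n - 1) / (q%:R ^+ d.+1 - 1) * gauss_binom R q n.-1 d.
Proof.
rewrite /gauss_binom big_ord_recl /= !subn0; congr (_ * _).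
by apply: eq_bigr => i _; rewrite /bump /= !add1n subSS -subn1 -subnDA add1n.
Qed.

Lemma gauss_binom_ge0 n d : 0 <= gauss_binom R q n d.
Proof. by apply: prodr_ge0 => i _; rewrite divr_ge0 ?subr1_exp_ge0. Qed.

Lemma gauss_binom_le m n d :
  (m <= n)%N -> gauss_binom R q m d <= gauss_binom R q n d.
Proof.
move=> mn; apply: ler_prod => i _; rewrite divr_ge0 ?subr1_exp_ge0 //=.
by rewrite ler_wpM2r ?invr_ge0 ?subr1_exp_ge0 // subr1_exp_le // leq_sub2r.
Qed.

Lemma sum_gauss_binom_le m n s : (m <= n)%N ->
  \sum_(j < s) gauss_binom R q m j <= \sum_(j < s) gauss_binom R q n j.
Proof. by move=> mn; apply: ler_sum => j _; apply: gauss_binom_le. Qed.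

End GaussBinomial.

(** * Counting the subspaces that contain a given one *)

Section Subspaces.

Variables (F : finFieldType) (vT : vectType F).
Implicit Types (B S T U W : {vspace vT}) (A : {set {vspace vT}}).
Local Notation q := #|F|.
Local Notation fvT := (finvect_type vT).

Lemma card_finField_gt1 : (1 < q)%N.
Proof. exact: finNzRing_gt1. Qed.

Lemma card_vectors U : #|[set v : fvT | (v : vT) \in U]| = (q ^ \dim U)%N.
Proof.
case: vT U => K c U; rewrite -(@card_vspace F (finvect_type (Vector.Pack c)) c U).
by apply: eq_card => v; rewrite inE.
Qed.

Lemma dim_add_line B (v : vT) : v \notin B -> \dim (B + <[v]>)%VS = (\dim B).+1.
Proof.
move=> vB; have v0 : v != 0 by apply: contraNneq vB => ->; rewrite mem0v.
apply/eqP; rewrite eqn_leq; apply/andP; split.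
  by rewrite (leq_trans (dimv_add_leqif _ _)) // dim_vline v0 addn1.
have sB : (B <= B + <[v]>)%VS by rewrite addvSl.
rewrite ltnNge; apply: contra vB => le; rewrite memvE.
have /eqP -> : B == (B + <[v]>)%VS by rewrite eqEdim sB.
exact: addvSr.
Qed.

(** For [B <= U] these stand for the [d]-dimensional subspaces of the quotient [U / B]. *)
Definition between B U d : {set {vspace vT}} :=
  [set T : {vspace vT} |
     [&& (B <= T)%VS, (T <= U)%VS & \dim T == (\dim B + d)%N]].

Lemma card_vectors_diff (R : numFieldType) B T : (B <= T)%VS ->
  \sum_(v : fvT | ((v : vT) \in T) && ((v : vT) \notin B)) 1
  = q%:R ^+ \dim T - q%:R ^+ \dim B :> R.
Proof.
move=> BT; rewrite -!natrX -!card_vectors -!sum1dep_card !natr_sum.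
rewrite [X in X - _](bigID (fun v : fvT => (v : vT) \in B)) /=.
rewrite [X in X + _ - _](_ : _ = \sum_(v : fvT | (v : vT) \in B) 1); last first.
  apply: eq_bigl => v; rewrite andbC.
  by case: (boolP (_ \in B)) => // /(subvP BT) ->.
by rewrite addrAC subrr add0r.
Qed.

(* Double counting of the pairs (v, T) with v in T but not in B: such a v turns
   B into B + <v>, which replaces d by d - 1. *)
Lemma card_between (R : numFieldType) B U d : (B <= U)%VS ->
  #|between B U d|%:R = gauss_binom R q (\dim U - \dim B) d.
Proof.
have qgt1 := card_finField_gt1.
elim: d B => [|d IH] B BU.
  rewrite gauss_binom0 (_ : between B U 0 = [set B]) ?cards1 //.
  apply/setP => T; rewrite !inE addn0; apply/and3P/eqP => [[BT _ /eqP dT]|->].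
    by apply/esym/eqP; rewrite eqEdim BT dT /=.
  by rewrite subvv.
set b := \dim B; set u := \dim U.
have bu : (b <= u)%N by apply: dimvS.
have q0 : (q%:R : R) ^+ b != 0 by rewrite expf_neq0 // pnatr_eq0 -lt0n ltnW.
have E : #|between B U d.+1|%:R * ((q%:R : R) ^+ (b + d.+1) - q%:R ^+ b)
   = (q%:R ^+ u - q%:R ^+ b) * gauss_binom R q (u - b).-1 d.
  transitivity (\sum_(T in between B U d.+1)
      \sum_(v : fvT | ((v : vT) \in T) && ((v : vT) \notin B)) (1 : R)).
    rewrite mulr_natl -sumr_const; apply: eq_bigr => T.
    by rewrite inE => /and3P[BT _ /eqP dT]; rewrite card_vectors_diff // dT.
  rewrite (exchange_big_dep
    (fun v : fvT => ((v : vT) \in U) && ((v : vT) \notin B))) /=; last first.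
    move=> T v; rewrite inE => /and3P[_ TU _] /andP[vT' ->].
    by rewrite (subvP TU).
  rewrite -(card_vectors_diff R BU) mulr_suml; apply: eq_bigr => v /andP[vU vB].
  have BvU : (B + <[v : vT]> <= U)%VS by rewrite subv_add BU -memvE.
  rewrite mul1r -subnS -(dim_add_line vB) -IH // -sum1_card natr_sum.
  apply: eq_bigl => T; rewrite !inE subv_add -memvE vB andbT dim_add_line //.
  by rewrite addSnnS -/b; case: (B <= T)%VS; case: (T <= U)%VS; case: (_ == _);
    rewrite ?andbF ?andbT.
have /mulfI : (q%:R ^+ b * (q%:R ^+ d.+1 - 1) : R) != 0.
  by rewrite mulf_neq0 // gt_eqF // subr1_exp_gt0.
apply; rewrite [LHS]mulrC [X in _ * X]mulrBr mulr1 -exprD E gauss_binomS.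
have -> : (q%:R : R) ^+ u = q%:R ^+ b * q%:R ^+ (u - b) by rewrite -exprD subnKC.
have d0 : (q%:R ^+ d.+1 - 1 : R) != 0 by rewrite gt_eqF // subr1_exp_gt0.
move: (gauss_binom _ _ _ _) (q%:R ^+ b : R) (q%:R ^+ (u - b) : R) => g x y.
by move: (q%:R ^+ d.+1 : R) d0 => z z0; field.
Qed.

(** These [T] index the indicators of [T <= W] that span the function space of the linear algebra
    bound. *)
Definition above B s : {set {vspace vT}} :=
  [set T : {vspace vT} | (B <= T)%VS && (\dim T <= \dim B + s)%N].

Lemma card_above (R : numFieldType) B s :
  #|above B s|%:R
  = \sum_(j < s.+1) gauss_binom R q (\dim {:vT} - \dim B) j :> R.
Proof.
transitivity (\sum_(j < s.+1) #|between B fullv j|%:R : R); last first.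
  by apply: eq_bigr => j _; rewrite card_between ?subvf.
rewrite -natr_sum; congr (_%:R).
(* On [above B s] the relative dimension is at most [s], so [inord] keeps its value. *)
rewrite -sum1_card
  (partition_big (fun T => inord (\dim T - \dim B) : 'I_s.+1) predT) //=.
apply: eq_bigr => j _; rewrite -sum1_card; apply: eq_bigl => T.
rewrite !inE subvf /=; case BT: (_ <= _)%VS => //=.
have := dimvS BT; have := ltn_ord j => js bT.
case: leqP => [le|lt] /=; last by apply/esym/negbTE; lia.
rewrite -val_eqE /= inordK; last by lia.
by apply/eqP/eqP; lia.
Qed.

Lemma subspace_of_dim U d : (d <= \dim U)%N ->
  exists2 T : {vspace vT}, (T <= U)%VS & \dim T = d.
Proof.
move=> dU; exists <<take d (vbasis U)>>%VS.
  by apply/span_subvP => v /mem_take /vbasis_mem.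
have /eqP -> : free (take d (vbasis U)).
  apply: (@catl_free _ _ (drop d (vbasis U))).
  by rewrite cat_take_drop (basis_free (vbasisP U)).
by rewrite size_takel // size_tuple.
Qed.

(** * Linear algebra bound for families with a common subspace *)

(* q ^ dim (U :&: W) counts the v in U with <[v]> <= W, and the indicators of
   T <= W multiply like [T1 <= W] * [T2 <= W] = [T1 + T2 <= W]. *)
Lemma prod_dim_cap_expansion B U (r : seq nat) s : (size r <= s)%N ->
  exists c : {vspace vT} -> rat, forall W, (B <= W)%VS ->
    \prod_(j <- r) (q%:R ^+ \dim (U :&: W)%VS - q%:R ^+ j)
    = \sum_(T in above B s) c T *+ (T <= W)%VS.
Proof.
elim: r s => [|j r IH] s.
  move=> _; exists (fun T => (T == B)%:R) => W BW.
  rewrite big_nil (bigD1 B) /=; last by rewrite inE subvv leq_addr.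
  by rewrite eqxx BW big1 ?addr0 // => T /andP[_ /negbTE ->]; rewrite mul0rn.
case: s => // s /IH [c Hc].
(* Multiplying by the indicator of [v \in W] moves the coefficient of [T] to [T + <[v]>]. The [if]
   extends [c] by zero from [above B s] to [above B s.+1]. *)
exists (fun T' => \sum_(v : fvT | (v : vT) \in U)
          \sum_(T in above B s | (T + <[v : vT]>)%VS == T') c T
        - q%:R ^+ j * (if T' \in above B s then c T' else 0)) => W BW.
rewrite big_cons Hc // mulrBl.
under [RHS]eq_bigr do rewrite mulrnBl.
rewrite sumrB; congr (_ - _); last first.
  rewrite mulr_sumr big_mkcond [RHS]big_mkcond; apply: eq_bigr => T _.
  case: ifP => [|_]; last by rewrite mulr0 mul0rn if_same.
  rewrite !inE => /andP[-> dT]; rewrite mulrnAr ifT //=.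
  by rewrite addnS (leq_trans dT).
have -> : (q%:R ^+ \dim (U :&: W)%VS : rat)
    = \sum_(v : fvT | (v : vT) \in U) ((v : vT) \in W)%:R.
  rewrite -natrX -card_vectors -sum1dep_card natr_sum.
  rewrite [RHS](eq_bigr (fun v : fvT => if (v : vT) \in W then 1%:R else 0)).
    by rewrite -big_mkcondr; apply: eq_bigl => v; rewrite memv_cap.
  by move=> v _; case: ifP.
rewrite mulr_suml.
under [RHS]eq_bigr do rewrite -sumrMnl.
rewrite [RHS]exchange_big /=; apply: eq_bigr => v vU.
rewrite mulr_sumr (partition_big (fun T => T + <[v : vT]>)%VS
  (mem (above B s.+1))) /=; last first.
  move=> T; rewrite !inE => /andP[BT dT]; rewrite (subv_trans BT) ?addvSl //=.
  rewrite (leq_trans (dimv_add_leqif _ _)) // addnS -addn1 leq_add //.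
  by rewrite dim_vline leq_b1.
apply: eq_bigr => T' _; rewrite -sumrMnl; apply: eq_bigr => T /andP[_ /eqP <-].
rewrite subv_add -memvE.
by case: (T <= W)%VS; case: (_ \in W);
  rewrite ?mulr1n ?mulr0n ?mul1r ?mul0r ?mulr0.
Qed.

(* The functions W |-> \prod_(j in l, j < dim U) (q ^ dim (U :&: W) - q ^ j),
   for U in A, vanish on W in A unless U <= W and do not vanish at U, so they
   are linearly independent. *)
Lemma card_family_above B A (l : seq nat) :
  (forall U, U \in A -> (B <= U)%VS) ->
  (forall U W, U \in A -> W \in A -> U != W -> \dim (U :&: W)%VS \in l) ->
  (#|A| <= #|above B (size l)|)%N.
Proof.
move=> BA lA; pose r U := [seq j <- l | (j < \dim U)%N].
have /fin_all_exists[c Hc] U : exists c : {vspace vT} -> rat,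
    forall W, (B <= W)%VS ->
    \prod_(j <- r U) (q%:R ^+ \dim (U :&: W)%VS - q%:R ^+ j)
    = \sum_(T in above B (size l)) c T *+ (T <= W)%VS.
  by apply: prod_dim_cap_expansion; rewrite size_filter count_size.
have q_inj (a b : nat) : ((q%:R : rat) ^+ a - q%:R ^+ b == 0) = (a == b).
  by rewrite subr_eq0 -!natrX eqr_nat eqn_exp2l // card_finField_gt1.
(* Row [i] holds the coordinates of the function of the [i]-th member in the indicators; free rows
   are at most as many as the columns. *)
pose P : 'M[rat]_(#|A|, #|above B (size l)|) :=
  \matrix_(i, k) c (enum_val i) (enum_val k).
suff /eqP <- : row_free P by apply: rank_leq_col.
apply: inj_row_free => v vP0; apply/eqP; apply: contraT => v0.
have [i vi] : exists i, v 0 i != 0.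
  apply/existsP; apply: contraR v0; rewrite negb_exists => /forallP v0.
  by apply/eqP/rowP => i; rewrite mxE; apply/eqP; rewrite -[_ == _]negbK v0.
(* The vanishing combination is evaluated at a member [W] of least dimension among those with
   nonzero coefficient: no other such member lies in [W], so only the term of [W] survives. *)
case: (@arg_minnP _ i (fun i' => v 0 i' != 0) (fun i' => \dim (enum_val i')) vi).
move=> {vi} i vi imin.
set W := enum_val i; have WA : W \in A by apply: enum_valP.
have : \sum_i' v 0 i' * (\prod_(j <- r (enum_val i'))
    (q%:R ^+ \dim (enum_val i' :&: W)%VS - q%:R ^+ j)) = 0.
  under eq_bigr do rewrite Hc ?BA // mulr_sumr.
  rewrite exchange_big /= big_enum_val big1 // => k _.
  have /matrixP/(_ 0 k) := vP0; rewrite !mxE => vPk.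
  transitivity ((\sum_j v 0 j * P j k) *+ (enum_val k <= W)%VS).
    by rewrite -sumrMnl; apply: eq_bigr => i' _; rewrite mxE mulrnAr.
  by rewrite vPk mul0rn.
rewrite (bigD1 i) //= [X in _ + X]big1; last first.
  move=> i' i'i.
  have [->|vi'] := eqVneq (v 0 i') 0; first by rewrite mul0r.
  apply/eqP; rewrite mulf_eq0 prodf_seq_eq0; apply/orP; right; apply/hasP.
  have UW : enum_val i' != W by rewrite (inj_eq enum_val_inj).
  exists (\dim (enum_val i' :&: W)%VS); last by rewrite /= q_inj.
  rewrite mem_filter lA ?enum_valP // andbT ltnNge; apply: contra UW => le.
  have /eqP UE : (enum_val i' :&: W)%VS == enum_val i' by rewrite eqEdim capvSl.
  by rewrite eqEdim -{1}UE capvSr imin.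
rewrite addr0 => /eqP; rewrite mulf_eq0 (negbTE vi) /= prodf_seq_eq0.
case/hasP => j; rewrite mem_filter capvv q_inj => /andP[jW _] /eqP Wj.
by rewrite Wj ltnn in jW.
Qed.

(** * A small subspace meeting every member in more than the least dimension *)

(* Adding members of A to X one at a time, each cutting down the intersection
   of the chosen ones, at most k - l + 1 additions bring its dimension below l;
   each addition costs at most k - l dimensions because it meets X in at least
   l. A member U meeting the sum only in dimension l would meet all the chosen
   members in the same subspace. *)
Lemma exists_cover A (l k : nat) :
  (forall U, U \in A -> (\dim U <= k)%N) ->
  (forall U W, U \in A -> W \in A -> (l <= \dim (U :&: W)%VS)%N) ->
  (\dim (\bigcap_(U in A) U)%VS < l)%N ->
  exists2 W : {vspace vT}, (\dim W <= k ^ 2)%N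
    & forall U, U \in A -> (l < \dim (U :&: W)%VS)%N.
Proof.
move=> Ak Al capA.
have [->|/set0Pn[X XA]] := eqVneq A set0.
  by exists 0%VS => [|U]; rewrite ?dimv0 // inE.
have lk : (l <= k)%N by rewrite (leq_trans (Al X X XA XA)) // capvv Ak.
(* [I] is the intersection and [W] the sum of the members chosen so far. The choice stops once
   [\dim I < l]; until then each step lowers [\dim I]. *)
have chain t : exists I W : {vspace vT},
    [/\ (\dim I < l)%N || (\dim I + t <= k)%N,
        (\dim W <= k + t * (k - l))%N, (X <= W)%VS
      & forall U, U \in A -> (\dim (U :&: W)%VS <= l)%N -> (U :&: W <= I)%VS].
  elim: t => [|t [I [W [dI dW XW UWI]]]].
    exists X, X; split; rewrite ?addn0 ?Ak ?orbT ?subvv // => U _ _.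
    exact: capvSr.
  have [Il|lI] := ltnP (\dim I) l.
    exists I, W; split; rewrite ?Il //.
    by rewrite (leq_trans dW) // leq_add2l leq_mul2r leqnSn orbT.
  have [Y YA IY] : exists2 Y, Y \in A & ~~ (I <= Y)%VS.
    apply/exists_inP; apply: contraLR capA; rewrite negb_exists_in -leqNgt.
    move=> /forall_inP IA; rewrite (leq_trans lI) //; apply/dimvS/subv_bigcapP.
    by move=> U /IA; rewrite negbK.
  exists (I :&: Y)%VS, (W + Y)%VS; split.
  - have lt : (\dim (I :&: Y)%VS < \dim I)%N.
      rewrite ltnNge; apply: contra IY => le.
      have /eqP <- : (I :&: Y)%VS == I by rewrite eqEdim capvSl.
      exact: capvSr.
    by move: dI lt lI; lia.
  - have := dimv_sum_cap W Y; have := Ak Y YA; have := Al X Y XA YA.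
    have := dimvS (capvS XW (subvv Y)); rewrite mulSn; move: dW lk.
    set x := (t * (k - l))%N; lia.
  - by rewrite (subv_trans XW) ?addvSl.
  move=> U UA dU; have sW : (U :&: W <= U :&: (W + Y))%VS by rewrite capvS ?addvSl.
  have sX : (U :&: X <= U :&: W)%VS by rewrite capvS.
  have sY : (U :&: Y <= U :&: (W + Y))%VS by rewrite capvS ?addvSr.
  have UW : (U :&: W)%VS = (U :&: (W + Y))%VS.
    apply/eqP; rewrite eqEdim sW (leq_trans dU) //.
    by rewrite (leq_trans (Al U X UA XA)) // dimvS.
  have UY : (U :&: Y)%VS = (U :&: (W + Y))%VS.
    by apply/eqP; rewrite eqEdim sY (leq_trans dU) // Al.
  by rewrite subv_cap -{1}UW UWI ?UW //= -UY capvSr.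
have [I [W [dI dW XW UWI]]] := chain (k - l).+1; exists W.
  (* [capA] forces [l > 0], so [k + (k - l + 1) * (k - l) <= k + k * (k - 1) = k ^ 2]. *)
  by move: dW lk capA; rewrite mulSn; nia.
move=> U UA; rewrite ltnNge; apply/negP => /(UWI U UA)/dimvS.
have := dimvS (capvS (subvv U) XW); have := Al U X UA XA.
by move: dI; lia.
Qed.

(** Each [U] contains some [d]-dimensional subspace of [U :&: W], possibly several, so the classes
    cover [A] but may overlap. *)
Lemma card_family_pigeonhole A W (d : nat) :
  (forall U, U \in A -> (d <= \dim (U :&: W)%VS)%N) ->
  (#|A| <= \sum_(T in between 0 W d) #|[set U in A | (T <= U)%VS]|)%N.
Proof.
move=> dA.
under eq_bigr do rewrite -sum1_card.
rewrite (exchange_big_dep (mem A)) /=; last by move=> T U _; rewrite inE => /andP[].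
rewrite -sum1_card; apply: leq_sum => U UA.
have [T TUW dT] := subspace_of_dim (dA U UA).
rewrite (bigD1 T) //= !inE UA sub0v dimv0 add0n dT eqxx andbT /=.
by rewrite !(subv_trans TUW) ?capvSl ?capvSr.
Qed.

(** The main bound with the hypothesis freed of the logarithm and [s = (size l).+1]. The least
    dimension [l1] is split off because the classes over [T] retain only [l]. *)
Lemma card_family_le (R : numFieldType) A (l1 : nat) (l : seq nat) (k : nat) :
  sorted ltn (l1 :: l) ->
  (forall U, U \in A -> (\dim U <= k)%N) ->
  (forall U W, U \in A -> W \in A -> U != W -> \dim (U :&: W)%VS \in l1 :: l) ->
  (q%:R ^+ (size l).+1 - 1) * gauss_binom R q (k ^ 2) l1.+1
    <= q%:R ^+ (\dim {:vT} - l1) - 1 ->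
  #|A|%:R <= \sum_(j < (size l).+2) gauss_binom R q (\dim {:vT} - l1) j.
Proof.
have qgt1 := card_finField_gt1.
move=> l_sorted Ak Al hk; set n := \dim {:vT}.
(* A lone member may have dimension below [l1]; with a second member, [Al1] holds for [U = W]
   too. *)
have [A1|A2] := leqP #|A| 1.
  rewrite big_ord_recl gauss_binom0 (@le_trans _ _ 1) ?ler_nat ?lern1 //.
  by rewrite lerDl sumr_ge0 // => j _; apply: gauss_binom_ge0.
have l_gt x : x \in l -> (l1 < x)%N.
  by move: x; apply/allP; rewrite (order_path_min ltn_trans).
have Al1 U W : U \in A -> W \in A -> (l1 <= \dim (U :&: W)%VS)%N.
  have ne U' W' : U' \in A -> W' \in A -> U' != W' -> (l1 <= \dim (U' :&: W')%VS)%N.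
    by move=> UA WA /(Al _ _ UA WA); rewrite inE => /predU1P[->|/l_gt/ltnW].
  move=> UA WA; have [<-|/ne] := eqVneq U W; last exact.
  have [X XA UX] : exists2 X, X \in A & U != X.
    move: A2; rewrite (cardsD1 U) UA ltnS => /card_gt0P[X].
    by rewrite !inE eq_sym => /andP[UX XA]; exists X.
  by rewrite capvv (leq_trans (ne _ _ UA XA UX)) // dimvS // capvSl.
have [capA|capA] := leqP l1 (\dim (\bigcap_(U in A) U)%VS).
  apply: le_trans (sum_gauss_binom_le R qgt1 _ (leq_sub2l n capA)).
  rewrite -card_above ler_nat (card_family_above (l := l1 :: l)) // => U UA.
  exact: (subv_bigcapP (subvv _)).
have [W dW WA] := exists_cover Ak Al1 capA.
have AT T : T \in between 0 W l1.+1 ->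
  #|[set U in A | (T <= U)%VS]|%:R
    <= \sum_(j < (size l).+1) gauss_binom R q (n - l1.+1) j.
  rewrite inE dimv0 add0n => /and3P[_ _ /eqP dT].
  rewrite -dT -card_above ler_nat; apply: card_family_above => [U|U U'].
    by rewrite inE => /andP[].
  rewrite !inE => /andP[UA TU] /andP[UA' TU'] ne.
  have := Al _ _ UA UA' ne; rewrite inE => /predU1P[E|//].
  have : (T <= U :&: U')%VS by rewrite subv_cap TU.
  by move=> /dimvS; rewrite dT E ltnn.
apply: le_trans (_ : gauss_binom R q (k ^ 2) l1.+1
  * \sum_(j < (size l).+1) gauss_binom R q (n - l1.+1) j <= _).
  apply: le_trans (_ : \sum_(T in between 0 W l1.+1)
    #|[set U in A | (T <= U)%VS]|%:R <= _).
    by rewrite -natr_sum ler_nat card_family_pigeonhole.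
  apply: le_trans (ler_sum _ AT) _; rewrite sumr_const -mulr_natl.
  rewrite card_between ?sub0v // dimv0 subn0 ler_wpM2r ?gauss_binom_le //.
  by rewrite sumr_ge0 // => j _; apply: gauss_binom_ge0.
(* Term [j] on the left is compared with term [j + 1] on the right. The factor from the recursion
   has denominator [q ^ (j + 1) - 1], largest at [j + 1 = s], the case given by [hk]. *)
rewrite mulr_sumr [leRHS]big_ord_recl -[leLHS]add0r lerD ?gauss_binom_ge0 //.
apply: ler_sum => j _; rewrite lift0 [leRHS]gauss_binomS -subnS.
rewrite ler_wpM2r ?gauss_binom_ge0 //.
rewrite ler_pdivlMr ?subr1_exp_gt0 //; apply: le_trans hk; rewrite mulrC.
by rewrite ler_wpM2r ?gauss_binom_ge0 // subr1_exp_le // ltn_ord.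
Qed.

End Subspaces.

(** * Translation of the logarithmic hypothesis *)

Theorem theorem1p15 (R : realType)
    (s : nat) (hs : (0 < s)%N) (l : s.-tuple nat) (hl : sorted ltn l)
    (F : finFieldType) (q : nat) (hq : #|F| = q)
    (vT : vectType F) (n : nat) (hn : \dim {:vT} = n)
    (V : {fset {vspace vT}})
    (hV : forall U W : {vspace vT}, U \in V -> W \in V -> U <> W ->
            \dim (U :&: W)%VS \in l)
    (k : nat) (hk : k = (\max_(W <- V) \dim W)%N)
    (l1 : nat) (hl1 : l1 = head 0%N l)
    (hlog : log_base (q%:R : R)
              ((q%:R ^+ s - 1) * gauss_binom R q (k ^ 2) (l1 + 1) + 1) + l1%:R
            <= n%:R) :
  (#|` V|)%:R <= \sum_(j < s.+1) gauss_binom R q (n - l1) j.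
Proof.
have qgt1 : (1 < q)%N by rewrite -hq card_finField_gt1.
pose A : {set {vspace vT}} := [set U | U \in V].
have -> : #|` V| = #|A|.
  by rewrite -(card_uniqP (fset_uniq V)); apply: eq_card => U; rewrite inE.
case: l => -[|l0 l'] /= sl in hl hV hl1 *; first by rewrite -(eqP sl) in hs.
move: hlog; rewrite addn1 -(eqP sl) /= -hn -hq; subst l0 => hlog.
apply: (card_family_le (l := l') (k := k)) => // [U|U W|].
- by rewrite inE hk => UV; apply: leq_bigmax_seq.
- by rewrite !inE => UV WV /eqP; apply: hV.
rewrite -hq in qgt1.
move: hlog; set x := (X in log_base _ (X + 1)) => hlog; rewrite -/x.
have x0 : 0 <= x by rewrite mulr_ge0 ?subr1_exp_ge0 ?gauss_binom_ge0.
have lnq : 0 < ln (#|F|%:R : R) by rewrite ln_gt0 // ltr1n.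
have lnx : 0 <= ln (x + 1) by rewrite ln_ge0 // lerDr.
(* The logarithm of [x + 1 >= 1] is nonnegative, so [l1 <= n] and the truncated [n - l1] is a true
   difference. *)
have l1n : (l1 <= \dim {:vT})%N.
  rewrite -(ler_nat R); apply: le_trans hlog; rewrite lerDr.
  by rewrite /log_base divr_ge0 // ltW.
have q0 : 0 < (#|F|%:R : R) by rewrite ltr0n ltnW.
rewrite lerBrDr -ler_ln ?posrE ?exprn_gt0 ?ltr_wpDl // lnXn //.
rewrite -[leRHS]mulr_natl natrB // -ler_pdivrMr //.
by rewrite lerBrDr.
Qed.
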